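(* Let $n \geq 2$ and let $H$ be a graph obtained from $n+1$ pairwise disjoint copies $K_n^0, K_n^1, \dots, K_n^n$ of the complete graph $K_n$ by adding, for every pair of distinct indices $i \neq j$, exactly one edge joining a vertex of $K_n^i$ to a vertex of $K_n^j$, in such a way that every vertex of each $K_n^i$ has exactly one neighbor not in $K_n^i$. Then $H$ is vertex-transitive.
   Context: A graph $G$ is vertex-transitive if for any two vertices $u,v$ of $G$ there is an automorphism of $G$ mapping $u$ to $v$. *)

(* Defs.v *)
From mathcomp Require Import all_boot all_fingroup.

Set Implicit Arguments.
Unset Strict Implicit.
Unset Printing Implicit Defensive.

Record sgraph := SGraph {
  vertex :> finType;
  adj : rel vertex;
  adj_sym : symmetric adj;
  adj_irrefl : irreflexive adj }.

Definition complete_adj (n : nat) : rel 'I_n := fun i j => i != j.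

Fact complete_adj_sym (n : nat) : symmetric (@complete_adj n).
Proof. by move=> i j; rewrite /complete_adj eq_sym. Qed.

Fact complete_adj_irrefl (n : nat) : irreflexive (@complete_adj n).
Proof. by move=> i; rewrite /complete_adj eqxx. Qed.

Definition complete_graph (n : nat) : sgraph :=
  SGraph (@complete_adj_sym n) (@complete_adj_irrefl n).

Definition automorphism (G : sgraph) (s : {perm G}) : Prop :=
  forall x y : G, adj (s x) (s y) = adj x y.

Definition vertex_transitive (G : sgraph) : Prop :=
  forall u v : G, exists s : {perm G}, automorphism s /\ s u = v.

(* The subgraph of G induced on S is isomorphic to F. *)
Definition is_copy (F G : sgraph) (S : {set G}) : Prop :=
  exists f : F -> G,
    [/\ injective f, f @: [set: F] = S & forall x y : F, adj (f x) (f y) = adj x y].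

(* K i is the vertex set of the i-th copy.  For disjoint K i and K j, the edges
   between them correspond one-to-one to the adjacent pairs in K i x K j; since
   the copies cover H and are induced, H has no edges other than those of the
   copies and the added ones. *)
Record joined_complete_copies (n : nat) (H : sgraph)
    (K : 'I_n.+1 -> {set H}) : Prop := {
  copies_disjoint : forall i j, i != j -> [disjoint K i & K j];
  copies_cover : \bigcup_i K i = [set: H];
  copies_complete : forall i, is_copy (complete_graph n) (K i);
  one_edge_between : forall i j, i != j ->
    #|[set p in setX (K i) (K j) | adj p.1 p.2]| = 1;
  one_outer_neighbor : forall i x, x \in K i ->
    #|[set y | adj x y & y \notin K i]| = 1 }.

(* Main.v *)
(* Label a vertex x of K i by the pair (i, j), where K j contains the outer
   neighbor of x.  Labels are in bijection with the ordered pairs of distinct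
   indices, because exactly one edge joins each pair of copies; moreover
   (i, j) is adjacent to (i', j') iff i = i' and j != j', or (i', j') = (j, i).
   So the symmetric group on the indices acts on H by automorphisms, and it is
   transitive on ordered pairs of distinct indices. *)
Require Import Defs.
From mathcomp Require Import all_boot all_fingroup.

(** The first transposition takes [a] to [a']; the second takes the image of [b] to [b'] and fixes
    [a'], which differs from both. *)
Lemma perm_two_transitive {T : finType} {a b a' b' : T} :
  a != b -> a' != b' -> exists s : {perm T}, s a = a' /\ s b = b'.
Proof.
move=> ab ab'; exists (tperm a a' * tperm (tperm a a' b) b')%g.
rewrite !permM tpermL; split; last by rewrite tpermL.
rewrite tpermD //; last by rewrite eq_sym.
by rewrite -[X in _ != X](tpermL a a') (inj_eq perm_inj) eq_sym.
Qed.

(** Adjacency depends only on equalities between label coordinates, which any permutation of [T]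
    applied to both coordinates preserves. *)
Lemma vertex_transitive_of_labels {G : sgraph} {T : finType} (l : G -> T * T) :
  injective l ->
  (forall x, (l x).1 != (l x).2) ->
  (forall i j, i != j -> exists x, l x = (i, j)) ->
  (forall x y, adj x y = if (l x).1 == (l y).1 then (l x).2 != (l y).2
                         else l y == ((l x).2, (l x).1)) ->
  vertex_transitive G.
Proof.
move=> l_inj l_offdiag l_onto adjE u v.
have [s [su1 su2]] := perm_two_transitive (l_offdiag u) (l_offdiag v).
have /fin_all_exists[f lf] x : exists y, l y = (s (l x).1, s (l x).2).
  by apply: l_onto; rewrite (inj_eq perm_inj) l_offdiag.
have f_inj : injective f.
  move=> x y fxy; apply: l_inj; move: (lf y); rewrite -fxy lf.
  by case=> /perm_inj e1 /perm_inj e2; rewrite [l x]surjective_pairing e1 e2 -surjective_pairing.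
exists (perm f_inj); split=> [x y|].
  by rewrite !permE !adjE !lf /= [l y]surjective_pairing !xpair_eqE !(inj_eq perm_inj).
by apply: l_inj; rewrite permE lf su1 su2 -surjective_pairing.
Qed.

Lemma complete_copy_adj {n : nat} {G : sgraph} {S : {set G}} {x y : G} :
  is_copy (complete_graph n) S -> x \in S -> y \in S -> adj x y = (x != y).
Proof.
case=> f [f_inj <- f_adj] /imsetP[a _ ->] /imsetP[b _ ->].
by rewrite f_adj (inj_eq f_inj).
Qed.

Lemma joined_copies_labels {n : nat} {H : sgraph} {K : 'I_n.+1 -> {set H}} :
  joined_complete_copies K ->
  exists l : H -> 'I_n.+1 * 'I_n.+1,
    [/\ injective l,
        forall x, (l x).1 != (l x).2,
        forall i j, i != j -> exists x, l x = (i, j) &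
        forall x y, adj x y = if (l x).1 == (l y).1 then (l x).2 != (l y).2
                              else l y == ((l x).2, (l x).1)].
Proof.
case=> disjK coverK completeK edgeK outerK.
have /fin_all_exists[c cP] x : exists i, x \in K i.
  have : x \in \bigcup_i K i by rewrite coverK inE.
  by case/bigcupP=> i _ xi; exists i.
have inK x i : (x \in K i) = (c x == i).
  apply/idP/eqP => [xi|<- //]; apply/eqP/negPn/negP => /disjK/disjointFr.
  by move/(_ x (cP x)); rewrite xi.
(* [o x] is the outer neighbor of [x]. *)
have /fin_all_exists[o oP] x :
    exists y, forall z, adj x z && (c z != c x) = (z == y).
  have /eqP/cards1P[y ey] := outerK _ _ (cP x).
  by exists y => z; move/setP/(_ z): ey; rewrite !inE inK.
have [adj_o c_o] : (forall x, adj x (o x)) /\ (forall x, c (o x) != c x).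
  by split=> x; have := oP x (o x); rewrite eqxx => /andP[].
have oK x : o (o x) = x.
  by apply/esym/eqP; rewrite -oP adj_sym adj_o eq_sym c_o.
(* Both [(x, o x)] and [(y, o y)] are the one edge between the same two copies. *)
have edge_uniq x y : c x = c y -> c (o x) = c (o y) -> x = y.
  move=> cxy coxy; have /eqP/cards1P[p /setP ep] :
      #|[set p in setX (K (c x)) (K (c (o x))) | adj p.1 p.2]| = 1.
    by apply: edgeK; rewrite eq_sym c_o.
  have := ep (x, o x); have := ep (y, o y).
  rewrite !inE /= !inK !adj_o cxy coxy !eqxx /=.
  by move=> /esym/eqP <- /esym/eqP[].
have l_inj : injective (fun x => (c x, c (o x))) by move=> x y [/edge_uniq]; apply.
exists (fun x => (c x, c (o x))); split=> //= [x|i j ij|x y].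
- by rewrite eq_sym c_o.
(* The end in [K i] of the edge joining [K i] to [K j] carries the label [(i, j)]. *)
- have /eqP/cards1P[[x y] /setP/(_ (x, y))] := edgeK _ _ ij.
  rewrite !inE eqxx /= !inK => /andP[/andP[/eqP ci /eqP cj] xy].
  exists x; rewrite ci; congr (_, _).
  by have /eqP <- : y == o x by rewrite -oP xy ci cj eq_sym.
- have [cxy|cxy] := eqVneq (c x) (c y).
    rewrite (complete_copy_adj (completeK (c x))) ?inK ?cxy //.
    by rewrite -(inj_eq l_inj) xpair_eqE cxy eqxx.
  (* As [o] is an involution, the swapped label of [x] is the label of [o x], so the claim becomes
     [y == o x]. *)
  have -> : (c (o x), c x) = (c (o x), c (o (o x))) by rewrite oK.
  by rewrite (inj_eq l_inj) -oP eq_sym cxy andbT.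
Qed.

Theorem theorem2 (n : nat) (n_ge2 : 2 <= n) (H : sgraph)
    (K : 'I_n.+1 -> {set H}) (HK : joined_complete_copies K) :
  vertex_transitive H.
Proof.
have [l [l_inj l_offdiag l_onto adjE]] := joined_copies_labels HK.
exact: vertex_transitive_of_labels l l_inj l_offdiag l_onto adjE.
Qed.
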